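(* Let $A \subseteq \mathbb{N}$ and let $B \subseteq \mathbb{N}$ be a finite set. For each $b \in B$ let $\delta_b \in \mathbb{N} \cup \{\infty\}$. Suppose the identity of formal power series \[ 1 + \sum_{a \in A} x^a = \prod_{b \in B} \frac{1 - x^{b\delta_b}}{1 - x^b} \] holds, where for $\delta_b = \infty$ the term $x^{b\delta_b}$ is interpreted as $0$. Define $\mathcal{A} := A$ and \[ \mathcal{B} := \bigcup_{b \in B} (b\mathbb{N} \setminus b\delta_b \mathbb{N}), \] where for $\delta_b = \infty$ the set $b\delta_b\mathbb{N}$ is interpreted as $\emptyset$. If for all $b, b' \in B$ with $b \neq b'$ we have $(b\mathbb{N} \setminus b\delta_b\mathbb{N}) \cap (b'\mathbb{N} \setminus b'\delta_{b'}\mathbb{N}) = \emptyset$ (with the same interpretation when $\delta_b$ or $\delta_{b'}$ is $\infty$), then $P(\mathcal{A}; n) = Q(\mathcal{B}; n)$ for all $n \in \mathbb{N}$.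
   Context: $\mathbb{N} = \{1, 2, 3, \dots\}$. For $a \in \mathbb{N}$, $a\mathbb{N} = \{an : n \in \mathbb{N}\}$. A partition of $n$ is a finite non-increasing sequence of positive integers (parts) summing to $n$; the multiplicity of a part is the number of times it occurs. For $\mathcal{A} \subseteq \mathbb{N}$, $P(\mathcal{A}; n)$ denotes the number of partitions of $n$ in which the multiplicity of every part (that occurs) belongs to $\mathcal{A}$. For $\mathcal{B} \subseteq \mathbb{N}$, $Q(\mathcal{B}; n)$ denotes the number of partitions of $n$ all of whose parts belong to $\mathcal{B}$. By convention $P(\mathcal{A}; 0) = Q(\mathcal{B}; 0) = 1$. *)

(* Defs.v *)
From HB Require Import structures.
From mathcomp Require Import all_boot all_order all_algebra finmap.
From mathcomp Require Import boolp classical_sets cardinality.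

Set Implicit Arguments.
Unset Strict Implicit.
Unset Printing Implicit Defensive.

Import GRing.Theory.

Local Open Scope classical_set_scope.
Local Open Scope ring_scope.

(* Formal power series, given by their sequence of coefficients.  The
   operations are not the pointwise ones on functions. *)
Section FormalPowerSeries.
Variable R : comUnitRingType.

Definition fps : Type := nat -> R.

Implicit Types (f g h : fps).

Definition fps_one : fps := fun n => (n == 0%N)%:R.

Definition fps_add f g : fps := fun n => f n + g n.

Definition fps_sub f g : fps := fun n => f n - g n.

Definition fps_mul f g : fps := fun n => \sum_(i < n.+1) f i * g (n - i)%N.

(* The first n coefficients of the inverse, obtained by solving
   \sum_(i <= m) g_i f_(m - i) = [m = 0] for g_m, successively in m. *)
Fixpoint fps_inv_coefs f n : seq R :=
  if n is m.+1 then
    let s := fps_inv_coefs f m in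
    rcons s ((f 0%N)^-1 * ((m == 0%N)%:R - \sum_(i < m) s`_i * f (m - i)%N))
  else [::].

(* Only meaningful when the constant coefficient is a unit, see fps_mulV. *)
Definition fps_inv f : fps := fun n => (fps_inv_coefs f n.+1)`_n.

Definition fps_div f g : fps := fps_mul f (fps_inv g).

(* x ^ e with e in N u {oo}, where None stands for oo and x ^ oo = 0. *)
Definition fps_Xn (e : option nat) : fps :=
  fun n => if e is Some k then (n == k)%:R else 0.

(* \sum_(a in A) x ^ a *)
Definition fps_sumX (A : set nat) : fps := fun n => (n \in A)%:R.

Lemma fps_mulC : commutative fps_mul.
Proof.
move=> f g; apply/funext => n; rewrite /fps_mul (reindex_inj rev_ord_inj) /=.
by apply: eq_bigr => i _; rewrite subSS subKn ?leq_ord // mulrC.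
Qed.

Lemma fps_mul1 : left_id fps_one fps_mul.
Proof.
move=> f; apply/funext => n; rewrite /fps_mul big_ord_recl /= mul1r subn0.
by rewrite big1 ?addr0 // => i _; rewrite /fps_one /= mul0r.
Qed.

Lemma fps_mul_poly f g N n : (n < N)%N ->
  fps_mul f g n = ((\poly_(i < N) f i) * (\poly_(i < N) g i))`_n.
Proof.
move=> nN; rewrite coefM; apply: eq_bigr => i _; rewrite !coef_poly.
by rewrite (leq_ltn_trans (leq_ord i) nN) (leq_ltn_trans (leq_subr _ _) nN).
Qed.

Lemma fps_mulA : associative fps_mul.
Proof.
move=> f g h; apply/funext => n.
rewrite /fps_mul.
under eq_bigr => i _ do rewrite -/(fps_mul g h _) (@fps_mul_poly g h n.+1) ?ltnS ?leq_subr //.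
under [RHS]eq_bigr => i _ do rewrite -/(fps_mul f g _) (@fps_mul_poly f g n.+1) //.
transitivity (((\poly_(i < n.+1) f i) *
  ((\poly_(i < n.+1) g i) * (\poly_(i < n.+1) h i)))`_n).
  by rewrite coefM; apply: eq_bigr => i _; rewrite coef_poly ltn_ord.
rewrite mulrA [LHS]coefM; apply: eq_bigr => i _.
by rewrite [X in _ * X]coef_poly ltnS leq_subr.
Qed.

HB.instance Definition _ :=
  Monoid.isComLaw.Build fps fps_one fps_mul fps_mulA fps_mulC fps_mul1.

Lemma size_fps_inv_coefs f n : size (fps_inv_coefs f n) = n.
Proof. by elim: n => //= n IHn; rewrite size_rcons IHn. Qed.

Lemma nth_fps_inv_coefs f n i : (i < n)%N ->
  (fps_inv_coefs f n)`_i = fps_inv f i.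
Proof.
elim: n => // n IHn; rewrite ltnS leq_eqVlt => /predU1P[->//|lt_in].
by rewrite /= nth_rcons size_fps_inv_coefs lt_in IHn.
Qed.

Lemma fps_mulV f : f 0%N \is a GRing.unit -> fps_mul f (fps_inv f) = fps_one.
Proof.
move=> Uf; apply/funext => n; rewrite fps_mulC /fps_mul big_ord_recr /= subnn.
rewrite {2}/fps_inv /= nth_rcons size_fps_inv_coefs ltnn eqxx mulrC mulVKr //.
under [X in _ - X]eq_bigr => i _ do rewrite nth_fps_inv_coefs //.
by rewrite addrC subrK.
Qed.

End FormalPowerSeries.

Definition is_partition (n : nat) (s : seq nat) : bool :=
  [&& sorted geq s, all (ltn 0%N) s & sumn s == n].

Lemma finite_is_partition (n : nat) (C : seq nat -> Prop) :
  finite_set [set s | is_partition n s /\ C s].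
Proof.
apply: (@sub_finite_set _ _ [set s | is_partition n s]) => [s []//|].
pose g (x : {k : 'I_n.+1 & k.-tuple 'I_n.+1}) := [seq val i | i <- tagged x].
apply: (@sub_finite_set _ _ (g @` setT)); last exact/finite_image/finite_finset.
move=> s /and3P[_ /allP s_gt0 /eqP sn].
have le_n i : i \in s -> (i < n.+1)%N.
  by move=> si; rewrite ltnS -sn (perm_sumn (perm_to_rem si)) leq_addr.
have sz : (size s < n.+1)%N.
  rewrite ltnS -sn; elim: s s_gt0 {sn le_n} => //= a s IHs s_gt0.
  rewrite -add1n leq_add ?IHs ?s_gt0 ?mem_head // => i si.
  by rewrite s_gt0 // inE si orbT.
exists (Tagged (fun k : 'I_n.+1 => k.-tuple 'I_n.+1)
  (i := Ordinal sz) (tcast (size_map _ s) (in_tuple (map inord s)))) => //.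
rewrite /g /= val_tcast /= -map_comp -[RHS]map_id.
by apply/eq_in_map => i /le_n lt_in; rewrite /= inordK.
Qed.

(* P(A; n).  fset_set is junk on infinite sets; finite_is_partition rules this
   out here and in num_parts. *)
Definition num_mult (A : set nat) (n : nat) : nat :=
  #|` fset_set [set s | is_partition n s /\
                        (forall p, p \in s -> A (count_mem p s))]|.

(* Q(B; n) *)
Definition num_parts (B : set nat) (n : nat) : nat :=
  #|` fset_set [set s | is_partition n s /\ (forall p, p \in s -> B p)]|.

(* e N for e in N u {oo}, where oo N is empty and N starts at 1. *)
Definition multiples (e : option nat) : set nat :=
  if e is Some a then [set (a * m)%N | m in [set m | (0 < m)%N]] else set0.

Definition omuln (b : nat) (d : option nat) : option nat := omap (muln b) d.

Definition block (b : nat) (d : option nat) : set nat :=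
  multiples (Some b) `\` multiples (omuln b d).

(* Main.v *)
(** The partitions counted by [P] have generating function
    prod_k F(x^k) with F = 1 + sum_(a in A) x^a, those counted by [Q] have
    prod_(m in BB) 1 / (1 - x^m), where BB is the union of the blocks.
    Substituting x^k in F * prod_b (1 - x^b) = prod_b (1 - x^(b delta_b)) and
    multiplying over k gives
      prod_k F(x^k) * prod_b prod_(b | m) (1 - x^m)
        = prod_b prod_(b delta_b | m) (1 - x^m).
    Since the blocks are disjoint, the double product on the left is
    prod_(m in BB) (1 - x^m) times the right-hand side, which cancels.
    The infinite products are cut off at k, m <= n, and the equalities hold up
    to degree n. *)
Require Import Defs.
From HB Require Import structures.
From mathcomp Require Import all_boot all_order all_algebra finmap.
From mathcomp Require Import boolp classical_sets cardinality.

Import GRing.Theory.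

Local Open Scope classical_set_scope.

(** * Power series up to a given degree, the substitution of x^k, and products of factors 1 - x^m *)

Section PowerSeries.
Local Open Scope ring_scope.
Context {R : comUnitRingType}.
Implicit Types (f g : fps R) (N k m : nat).

(** Congruence modulo x^(N+1), which lets finite products stand in for infinite ones. *)
Definition eq_upto N f g := forall n, (n <= N)%N -> f n = g n.

Lemma eq_upto_trans N g f h : eq_upto N f g -> eq_upto N g h -> eq_upto N f h.
Proof. by move=> fg gh n nN; rewrite fg ?gh. Qed.

Lemma eq_upto_mul N f f' g g' : eq_upto N f f' -> eq_upto N g g' ->
  eq_upto N (fps_mul f g) (fps_mul f' g').
Proof.
move=> ff gg n nN; apply: eq_bigr => i _.
by rewrite ff ?gg // (leq_trans _ nN) ?leq_subr // -ltnS.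
Qed.

Lemma eq_upto_big N (I : Type) (r : seq I) (P : pred I) (F G : I -> fps R) :
  (forall i, P i -> eq_upto N (F i) (G i)) ->
  eq_upto N (\big[@fps_mul R/fps_one R]_(i <- r | P i) F i)
            (\big[@fps_mul R/fps_one R]_(i <- r | P i) G i).
Proof. by move=> FG; apply: big_ind2 => // *; exact: eq_upto_mul. Qed.

(* The substitution f(x) |-> f(x ^ k). *)
Definition fps_dilate k f : fps R :=
  fun n => if (k %| n)%N then f (n %/ k)%N else 0.

Lemma fps_dilate_one k : (0 < k)%N -> fps_dilate k (fps_one R) = fps_one R.
Proof.
move=> k0; apply/funext => n; rewrite /fps_dilate /fps_one.
case: ifPn => [/dvdnP[q ->]|]; first by rewrite mulnK // muln_eq0 (gtn_eqF k0) orbF.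
by case: n => // /negP[]; rewrite dvdn0.
Qed.

(** Coefficient n involves only the truncations of [f] and [g] to degree n, and on polynomials the
    substitution is composition with ['X^k], which is multiplicative. *)
Lemma fps_dilate_mul k f g : (0 < k)%N ->
  fps_dilate k (fps_mul f g) = fps_mul (fps_dilate k f) (fps_dilate k g).
Proof.
move=> k0; apply/funext => n; pose tr h : {poly R} := \poly_(i < n.+1) h i.
have trE h i : (i <= n)%N -> (tr h \Po 'X^k)`_i = fps_dilate k h i.
  move=> le_in; rewrite coef_comp_poly_Xn // /fps_dilate coef_poly.
  by rewrite ltnS (leq_trans (leq_div _ _) le_in).
transitivity (((tr f * tr g) \Po 'X^k)`_n).
  rewrite coef_comp_poly_Xn // /fps_dilate; case: ifP => // _.
  by rewrite (@fps_mul_poly _ f g n.+1) // ltnS leq_div.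
rewrite comp_polyM coefM; apply: eq_bigr => i _.
by rewrite !trE ?leq_subr // -ltnS.
Qed.

Lemma fps_dilate_prod k (I : Type) (r : seq I) (F : I -> fps R) : (0 < k)%N ->
  fps_dilate k (\big[@fps_mul R/fps_one R]_(i <- r) F i) =
  \big[@fps_mul R/fps_one R]_(i <- r) fps_dilate k (F i).
Proof.
move=> k0; apply: big_morph => [f g|]; first exact: fps_dilate_mul.
exact: fps_dilate_one.
Qed.

Lemma fps_dilate_1subX k m : (0 < k)%N ->
  fps_dilate k (fps_sub (fps_one R) (fps_Xn R (Some m))) =
  fps_sub (fps_one R) (fps_Xn R (Some (k * m)%N)).
Proof.
move=> k0; rewrite -{2}(fps_dilate_one _ k0); apply/funext => n.
rewrite /fps_dilate /fps_sub /fps_Xn; case: ifPn => [/dvdnP[q ->]|kn].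
  by rewrite mulnK // mulnC eqn_pmul2l.
by case: eqP kn => [->|_ _]; rewrite ?dvdn_mulr // subrr.
Qed.

Lemma fps_sub_one_Xinf : fps_sub (fps_one R) (fps_Xn R None) = fps_one R.
Proof. by apply/funext => n; rewrite /fps_sub subr0. Qed.

(** The dilated all-ones series is 1 / (1 - x^m); dilation reduces this to m = 1, where consecutive
    coefficients cancel. *)
Lemma fps_geometric m : (0 < m)%N ->
  fps_mul (fps_dilate m (fun=> 1)) (fps_sub (fps_one R) (fps_Xn R (Some m)))
  = fps_one R.
Proof.
move=> m0; rewrite -{2}[m]muln1 -fps_dilate_1subX // -fps_dilate_mul //.
rewrite -[RHS](fps_dilate_one _ m0); congr fps_dilate.
apply/funext => n; rewrite fps_mulC /fps_mul big_ord_recl mulr1.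
case: n => [|n]; first by rewrite big_ord0 addr0 /fps_sub /= subr0.
rewrite big_ord_recl big1 => [|i _]; rewrite /fps_sub /fps_one /fps_Xn /=.
  by rewrite subr0 mulr1 add0r addr0 subrr.
by rewrite subrr mul0r.
Qed.

Lemma fps_dilate_indicator k (M : pred nat) n :
  fps_dilate k (fun j => (M j)%:R) n =
  ((k %| n)%N && M (n %/ k)%N)%:R :> R.
Proof. by rewrite /fps_dilate; case: (k %| n)%N. Qed.

(** For e = b finite, the factor of index k is 1 - x^(kb). Those with kb > N are 1 up to degree N,
    and the remaining exponents kb are exactly the multiples of b in [1, N]. For e infinite both
    products are 1. *)
Lemma prod_1subX_multiples N (e : option nat) :
  (forall m, e = Some m -> (0 < m)%N) ->
  eq_upto N
    (\big[@fps_mul R/fps_one R]_(k <- iota 1 N)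
      fps_dilate k (fps_sub (fps_one R) (fps_Xn R e)))
    (\big[@fps_mul R/fps_one R]_(m <- iota 1 N | m \in multiples e)
      fps_sub (fps_one R) (fps_Xn R (Some m))).
Proof.
case: e => [b b0|_]; last first.
  rewrite fps_sub_one_Xinf big_seq [X in eq_upto _ X _]big1 => [|k]; last first.
    by rewrite mem_iota => /andP[k0 _]; exact: fps_dilate_one.
  by rewrite big_pred0 // => m; rewrite /= in_set0.
have {}b0 := b0 _ erefl.
pose D m := fps_sub (fps_one R) (fps_Xn R (Some m)).
have -> : \big[@fps_mul R/fps_one R]_(k <- iota 1 N) fps_dilate k (D b) =
    \big[@fps_mul R/fps_one R]_(m <- [seq (k * b)%N | k <- iota 1 N]) D m.
  rewrite big_map; apply: eq_big_seq => k; rewrite mem_iota => /andP[k0 _].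
  exact: fps_dilate_1subX.
rewrite (bigID (fun m => (m <= N)%N)).
rewrite -[X in eq_upto _ _ X](Monoid.mulm1 (@fps_mul R)).
apply: eq_upto_mul; last first.
  rewrite -[X in eq_upto _ _ X](@big1_eq _ _ (@fps_mul R) _
    [seq (k * b)%N | k <- iota 1 N] (fun m => ~~ (m <= N)%N)).
  apply: eq_upto_big => m; rewrite -ltnNge => Nm n nN.
  by rewrite /D /fps_sub /fps_Xn (@ltn_eqF n m) ?subr0 // (leq_ltn_trans nN).
rewrite -big_filter -[X in eq_upto _ _ X]big_filter /= => n _.
congr (_ n); apply/perm_big/uniq_perm.
- apply/filter_uniq; rewrite map_inj_uniq ?iota_uniq // => x y /eqP.
  by rewrite eqn_pmul2r // => /eqP.
- exact/filter_uniq/iota_uniq.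
move=> m; rewrite !mem_filter !mem_iota add1n ltnS.
apply/idP/idP => [/andP[mN /mapP[k]]|/and3P[/set_mem[k /= k0 <-] _ mN]].
  rewrite mem_iota => /andP[k0 _] mkb; apply/and3P; split => //.
    by apply/mem_set; exists k; rewrite // mkb mulnC.
  by rewrite mkb muln_gt0 k0.
rewrite mN; apply/mapP; exists k; last by rewrite mulnC.
by rewrite mem_iota k0 add1n ltnS (leq_trans _ mN) ?leq_pmull.
Qed.

End PowerSeries.

(** * Generating functions of partitions with prescribed multiplicities *)

Section Partitions.
Implicit Types (M : nat -> pred nat) (N n p k : nat) (s t : seq nat).

(* The partitions of n with parts at most N in which p has multiplicity in M p
   for all p in [1, N]; i is the contribution of the part N to n. *)
Fixpoint restricted_partitions M N n : seq (seq nat) :=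
  if N is N'.+1 then
    [seq nseq (i %/ N) N ++ t |
       i <- [seq i <- iota 0 n.+1 | (N %| i) && M N (i %/ N)],
       t <- restricted_partitions M N' (n - i)]
  else if n is 0 then [:: [::]] else [::].

Lemma geq_trans : transitive geq.
Proof. by move=> p q r qp pr; exact: leq_trans pr qp. Qed.

Lemma sorted_geq_nseq_cat k p t : sorted geq t -> all (leq^~ p) t ->
  sorted geq (nseq k p ++ t).
Proof.
move=> t_sorted t_le.
have: path geq p t by rewrite (path_sortedE geq_trans) t_le.
by elim: k => [//|[//|k] IHk] /= /IHk /= ->; rewrite leqnn.
Qed.

(** As p bounds the parts, its copies come first: both sides are sorted and are permutations of each
    other. *)
Lemma sorted_geq_split p s : sorted geq s -> all (leq^~ p) s ->
  s = nseq (count_mem p s) p ++ [seq q <- s | q != p].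
Proof.
move=> sorted_s /allP s_le.
apply: (sorted_eq geq_trans) => //.
- by move=> a b; rewrite andbC => /anti_leq.
- apply: sorted_geq_nseq_cat; first exact: (sorted_filter geq_trans).
  by apply/allP => q; rewrite mem_filter => /andP[_ /s_le].
- rewrite perm_sym; apply: perm_trans (permEl (perm_filterC (pred1 p) s)).
  rewrite perm_cat2r (_ : filter (pred1 p) s = nseq (count_mem p s) p) //.
  by rewrite -size_filter; apply/all_pred1P/filter_all.
Qed.

Lemma count_mem_part p q k t : count_mem p (nseq k q ++ t) =
  ((q == p) * k + count_mem p t)%N.
Proof. by rewrite count_cat count_nseq. Qed.

Lemma restricted_partitionsP M N n s :
  reflect [/\ is_partition n s, all (leq^~ N) s &
              forall p, (0 < p <= N)%N -> M p (count_mem p s)]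
          (s \in restricted_partitions M N n).
Proof.
elim: N n s => [|N IHN] n s.
  apply: (iffP idP) => [|[/and3P[_ s_gt0 /eqP <-] s_le0 _]].
    by case: n => // /[!inE] /eqP ->; split=> // p; rewrite leqn0; case: p.
  by case: s s_gt0 s_le0 => //= a s /andP[]; rewrite leqn0; case: a.
apply: (iffP idP) => [/allpairsPdep[i [t [i_in t_in ->]]]|].
  move: i_in; rewrite mem_filter mem_iota ltnS => /andP[/andP[Ni MNi] /= i_le].
  have [/and3P[t_sorted t_gt0 /eqP t_sum] t_le t_M] := IHN _ _ t_in.
  have N_notin : count_mem N.+1 t = 0%N.
    by apply/count_memPn/negP => /(allP t_le); rewrite ltnn.
  split.
  - apply/and3P; split.
    + apply: sorted_geq_nseq_cat => //.
      by apply: sub_all t_le => q /leqW.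
    + by rewrite all_cat all_nseq orbT.
    + by rewrite sumn_cat sumn_nseq mulnC divnK // t_sum subnKC.
  - rewrite all_cat all_nseq leqnn orbT /=.
    by apply: sub_all t_le => q /leqW.
  - move=> p /andP[p0]; rewrite leq_eqVlt => /predU1P[->|pN].
      by rewrite count_mem_part eqxx mul1n N_notin addn0.
    by rewrite count_mem_part gtn_eqF //= t_M // p0.
case=> /and3P[s_sorted s_gt0 /eqP s_sum] s_le s_M.
have s_split := sorted_geq_split _ _ s_sorted s_le.
set k := count_mem N.+1 s in s_split; set t := [seq q <- s | _] in s_split.
have s_sum' : (k * N.+1 + sumn t = n)%N.
  by rewrite -s_sum s_split sumn_cat sumn_nseq mulnC.
apply/allpairsPdep; exists (k * N.+1)%N, t; split; last by rewrite mulnK.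
  rewrite mem_filter mem_iota dvdn_mull // mulnK // s_M ?leqnn //=.
  by rewrite add0n ltnS -s_sum' leq_addr.
apply/IHN; split.
- apply/and3P; split; last by rewrite -s_sum' addKn.
    exact: (sorted_filter geq_trans).
  by rewrite all_filter; apply: sub_all s_gt0 => q q0; apply/implyP.
- apply/allP => q; rewrite mem_filter => /andP[qN /(allP s_le)].
  by rewrite leq_eqVlt (negPf qN).
- move=> p /andP[p0 pN]; have := s_M p; rewrite p0 (leqW pN) => /(_ isT).
  by rewrite s_split count_mem_part gtn_eqF.
Qed.

Lemma restricted_partitions_uniq M N n : uniq (restricted_partitions M N n).
Proof.
elim: N n => [|N IHN] n; first by case: n.
apply: allpairs_uniq_dep => [|i _|].
- exact/filter_uniq/iota_uniq.
- exact: IHN.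
move=> _ _ /allpairsPdep[i [t [i_in t_in ->]]]
  /allpairsPdep[j [u [j_in u_in ->]]].
have N_notin l v : v \in restricted_partitions M N l -> count_mem N.+1 v = 0%N.
  move=> /restricted_partitionsP[_ /allP v_le _].
  by apply/count_memPn/negP => /v_le; rewrite ltnn.
move: i_in j_in; rewrite !mem_filter => /andP[/andP[Ni _] _] /andP[/andP[Nj _] _].
move=> /= eq_tu; have := congr1 (count_mem N.+1) eq_tu.
rewrite !count_mem_part eqxx !mul1n (N_notin _ _ t_in) (N_notin _ _ u_in) !addn0.
(* The multiplicity of [N.+1] recovers [i], because the tails have no part [N.+1]; the tails then
   agree by cancelling a common prefix. *)
move=> eq_div; have eq_ij : i = j by rewrite -(divnK Ni) eq_div divnK.
by move: eq_tu; rewrite eq_ij => /eqP; rewrite eqseq_cat // eqxx => /eqP ->.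
Qed.

(** The recursion on N is a Cauchy product: the new factor has coefficient 1 at exactly those [i]
    that the filter keeps, and the tail accounts for degree n - i. *)
Lemma size_restricted_partitions (R : comUnitRingType) M N n :
  (size (restricted_partitions M N n))%:R%R =
  (\big[@fps_mul R/fps_one R]_(k <- iota 1 N)
    fps_dilate k (fun j => (M k j)%:R%R)) n.
Proof.
elim: N n => [|N IHN] n; first by rewrite big_nil; case: n.
have -> : iota 1 N.+1 = iota 1 N ++ [:: N.+1] by rewrite -[in LHS](addn1 N) iotaD.
rewrite big_cat big_seq1 [RHS]/= fps_mulC size_allpairs_dep sumnE big_map.
rewrite big_filter big_mkcond.
rewrite -[iota 0 n.+1]/(index_iota 0 n.+1) big_mkord natr_sum.
apply: eq_bigr => i _; rewrite -IHN fps_dilate_indicator.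
by case: ifP => _; rewrite ?mul1r ?mul0r.
Qed.

(** Common to both counts: for P the set [M p] of allowed multiplicities is the same for all p, for
    Q it is everything or only 0, according to p. *)
Lemma card_partitions_prod (R : comUnitRingType) M N n (C : seq nat -> Prop) :
  (n <= N)%N ->
  (forall s, is_partition n s ->
    C s <-> forall p, (0 < p)%N -> M p (count_mem p s)) ->
  (forall p, (0 < p)%N -> M p 0%N) ->
  (#|` fset_set [set s | is_partition n s /\ C s]|)%:R%R =
  (\big[@fps_mul R/fps_one R]_(k <- iota 1 N)
    fps_dilate k (fun j => (M k j)%:R%R)) n.
Proof.
move=> nN CM M0; rewrite -size_restricted_partitions; congr (_%:R)%R.
rewrite -(undup_id (restricted_partitions_uniq M N n)) -card_fseq; congr #|` _|.
apply/fsetP => s; rewrite in_fset_set; last exact: finite_is_partition.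
rewrite inE /=; apply/idP/idP.
  move=> /set_mem[/= part_s /(CM s part_s) s_M].
  apply/restricted_partitionsP; split => // [|p /andP[p0 _]]; last exact: s_M.
  have /and3P[_ _ /eqP s_sum] := part_s.
  apply/allP => q qs; apply: leq_trans nN.
  by rewrite -s_sum (perm_sumn (perm_to_rem qs)) leq_addr.
move=> /restricted_partitionsP[part_s /allP s_le s_M].
apply/mem_set; split => //; apply/(CM s part_s) => p p0.
have [pN|Np] := leqP p N; first by rewrite s_M ?p0.
(* Parts beyond N do not occur, so only multiplicity 0 has to be allowed for them. *)
suff /count_memPn -> : p \notin s by exact: M0.
by apply/negP => /s_le; rewrite leqNgt Np.
Qed.

End Partitions.

(** * Regrouping of products over multiples and over disjoint blocks *)

Lemma multiples_omuln_sub b (d : option nat) :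
  (forall e, d = Some e -> (0 < e)%N) ->
  multiples (omuln b d) `<=` multiples (Some b).
Proof.
case: d => [e /(_ e erefl) e0|_] //= _ [m /= m0 <-].
by exists (e * m)%N; rewrite ?mulnA //= muln_gt0 e0.
Qed.

Lemma big_multiples_split (T : Type) (idx : T) (op : Monoid.com_law idx)
    (r : seq nat) (F : nat -> T) b (d : option nat) :
  (forall e, d = Some e -> (0 < e)%N) ->
  \big[op/idx]_(m <- r | m \in multiples (Some b)) F m =
  op (\big[op/idx]_(m <- r | m \in block b d) F m)
     (\big[op/idx]_(m <- r | m \in multiples (omuln b d)) F m).
Proof.
move=> d0; rewrite (bigID (fun m => m \in multiples (omuln b d))) Monoid.mulmC.
congr (op _ _); apply: eq_bigl => m; first by rewrite in_setD.
apply/andb_idl => /set_mem /(multiples_omuln_sub _ _ d0).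
exact: mem_set.
Qed.

(** After exchanging the products, an m in the union contributes a single factor, since disjointness
    leaves only one b with m in [S b]. *)
Lemma big_bigcup_fset (T : Type) (idx : T) (op : Monoid.com_law idx)
    (r : seq nat) (F : nat -> T) (B : {fset nat}) (S : nat -> set nat) :
  (forall b b', b \in B -> b' \in B -> b <> b' -> S b `&` S b' = set0) ->
  \big[op/idx]_(b <- B) \big[op/idx]_(m <- r | m \in S b) F m =
  \big[op/idx]_(m <- r | m \in \bigcup_(b in [set` B]) S b) F m.
Proof.
move=> disjS; under eq_bigr do rewrite big_mkcond.
rewrite exchange_big [RHS]big_mkcond; apply: eq_bigr => m _.
case: ifPn => [/set_mem[b /= bB mSb]|m_notin].
  rewrite (bigD1_seq b) ?fset_uniq //= mem_set //.
  rewrite big_seq_cond big1 ?Monoid.mulm1 //.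
  move=> b' /andP[b'B /eqP b'b]; case: ifPn => // /set_mem mSb'.
  by have: (S b' `&` S b) m by []; rewrite disjS.
apply: big1_seq => b /andP[_ bB]; case: ifPn => // /set_mem mSb.
by case/negP: m_notin; apply/mem_set; exists b.
Qed.

Theorem theorem2p1 (A : set nat) (B : {fset nat}) (delta : nat -> option nat)
  (A_pos : forall a, A a -> (0 < a)%N)
  (B_pos : forall b, b \in B -> (0 < b)%N)
  (delta_pos : forall b d, b \in B -> delta b = Some d -> (0 < d)%N)
  (identity :
    fps_add (fps_one int) (fps_sumX int A) =
    \big[@fps_mul int/fps_one int]_(b <- B)
      fps_div (fps_sub (fps_one int) (fps_Xn int (omuln b (delta b))))
              (fps_sub (fps_one int) (fps_Xn int (Some b))))
  (disjoint_blocks : forall b b', b \in B -> b' \in B -> b <> b' ->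
    block b (delta b) `&` block b' (delta b') = set0) :
  forall n : nat, (0 < n)%N ->
    num_mult A n = num_parts (\bigcup_(b in [set` B]) block b (delta b)) n.
Proof.
move=> n _; set S := \bigcup_(b in _) _.
pose D e := fps_sub (fps_one int) (fps_Xn int e).
pose F := fps_add (fps_one int) (fps_sumX int A).
pose PF := \big[@fps_mul int/fps_one int]_(k <- iota 1 n) fps_dilate k F.
pose QF := \big[@fps_mul int/fps_one int]_(k <- iota 1 n)
  fps_dilate k (fun j => ((j == 0%N) || (k \in S))%:R%R).
pose U := \big[@fps_mul int/fps_one int]_(m <- iota 1 n | m \in S) D (Some m).
have count_gt0 p (s : seq nat) : (count_mem p s == 0%N) = (p \notin s).
  by rewrite -has_pred1 has_count lt0n negbK.
have part_gt0 s p : is_partition n s -> p \in s -> (0 < p)%N.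
  by move=> /and3P[_ /allP s_gt0 _] /s_gt0.
have mult_coef : (num_mult A n)%:R%R = PF n.
  rewrite (card_partitions_prod int (fun _ j => (j == 0%N) || (j \in A)) n) //.
    congr (_ n); apply: eq_bigr => k _; congr fps_dilate; apply/funext => -[|j].
      (* The constant coefficient of [F] is 1 and not 2, because 0 is not in [A]. *)
      rewrite /F /fps_add /fps_one /fps_sumX /= memNset ?addr0 //.
      by move=> /A_pos.
    by rewrite /F /fps_add /fps_one /fps_sumX /= add0r.
  move=> s part_s; split => [s_A p p0|s_A p ps].
    by rewrite count_gt0; case: (boolP (p \in s)) => //= /s_A /mem_set.
  have := s_A p (part_gt0 s p part_s ps).
  by rewrite count_gt0 ps /= => /set_mem.
have parts_coef : (num_parts S n)%:R%R = QF n.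
  apply: (card_partitions_prod int (fun k j => (j == 0%N) || (k \in S)) n) => //.
  move=> s part_s; split => [s_S p p0|s_S p ps].
    by rewrite count_gt0; case: (boolP (p \in s)) => //= /s_S /mem_set.
  have := s_S p (part_gt0 s p part_s ps).
  by rewrite count_gt0 ps /= => /set_mem.
have QFU : fps_mul QF U = fps_one int.
  rewrite /QF /U [X in fps_mul _ X]big_mkcond -big_split big1_seq // => k.
  (* For k in [S] the factor of [QF] is the geometric series, inverse to 1 - x^k; otherwise it is
     1. *)
  rewrite mem_iota => /andP[_ /andP[k0 _]]; case: ifP => kS /=.
    by under eq_fun do rewrite orbT; exact: fps_geometric.
  rewrite fps_mulC fps_mul1 -(fps_dilate_one _ k0); congr fps_dilate.
  by apply/funext => j; rewrite orbF.
have clear_denom : fps_mul F (\big[@fps_mul int/fps_one int]_(b <- B) D (Some b))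
    = \big[@fps_mul int/fps_one int]_(b <- B) D (omuln b (delta b)).
  rewrite /F identity -big_split; apply: eq_big_seq => b /B_pos b0 /=.
  rewrite /fps_div -fps_mulA [X in fps_mul _ X]fps_mulC fps_mulV.
    by rewrite fps_mulC fps_mul1.
  by case: b b0 => // b _; rewrite /fps_sub /fps_one /fps_Xn /= subr0 unitr1.
pose V e := \big[@fps_mul int/fps_one int]_(m <- iota 1 n | m \in multiples e)
  D (Some m).
(* The right-hand side of the product identity, to be cancelled at the end. *)
pose W := \big[@fps_mul int/fps_one int]_(b <- B) V (omuln b (delta b)).
have prod_dilate (e : nat -> option nat) :
    (forall b m, b \in B -> e b = Some m -> (0 < m)%N) ->
    eq_upto n
      (\big[@fps_mul int/fps_one int]_(k <- iota 1 n)
        fps_dilate k (\big[@fps_mul int/fps_one int]_(b <- B) D (e b)))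
      (\big[@fps_mul int/fps_one int]_(b <- B) V (e b)).
  move=> e0.
  (* Dilation distributes over the product on b, so the products over k and b can be exchanged and
     each b treated separately. *)
  rewrite (_ : \big[_/_]_(k <- _) _ = \big[@fps_mul int/fps_one int]_(b <- B)
    \big[@fps_mul int/fps_one int]_(k <- iota 1 n) fps_dilate k (D (e b))).
    rewrite big_seq [X in eq_upto _ _ X]big_seq; apply: eq_upto_big => b bB.
    by apply: prod_1subX_multiples => m; exact: e0.
  rewrite [RHS]exchange_big; apply: eq_big_seq => k.
  by rewrite mem_iota => /andP[k0 _]; exact: fps_dilate_prod.
(* By disjointness U W is the full product over b and the multiples of b. Up to degree n this is the
   product of the dilated denominators, which [PF] turns into that of the dilated numerators, hence
   into W. *)
have PFUW : eq_upto n (fps_mul (fps_mul PF U) W) W.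
  have -> : fps_mul (fps_mul PF U) W =
      fps_mul PF (\big[@fps_mul int/fps_one int]_(b <- B) V (Some b)).
    rewrite -fps_mulA; congr fps_mul.
    rewrite /U /W -(big_bigcup_fset _ _ (@fps_mul int)) // -big_split.
    apply: eq_big_seq => b bB; rewrite /V -big_multiples_split // => e.
    exact: delta_pos.
  apply: (eq_upto_trans _ (fps_mul PF
    (\big[@fps_mul int/fps_one int]_(k <- iota 1 n) fps_dilate k
      (\big[@fps_mul int/fps_one int]_(b <- B) D (Some b))))).
    apply: eq_upto_mul => // m mn; symmetry; apply: prod_dilate mn.
    by move=> b _ bB [<-]; exact: B_pos.
  rewrite /PF -big_split /=.
  rewrite (_ : \big[_/_]_(k <- _) _ =
    \big[@fps_mul int/fps_one int]_(k <- iota 1 n) fps_dilate k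
      (\big[@fps_mul int/fps_one int]_(b <- B) D (omuln b (delta b)))).
    apply: (prod_dilate (fun b => omuln b (delta b))) => b m bB.
    case deltab: (delta b) => [d|] //= [<-].
    by rewrite muln_gt0 B_pos // (delta_pos b).
  apply: eq_big_seq => k; rewrite mem_iota => /andP[k0 _].
  by rewrite -clear_denom fps_dilate_mul.
(* The inverse of W is a product of geometric series, one for each factor 1 - x^m. *)
have [W' WW'] : exists W', fps_mul W W' = fps_one int.
  exists (\big[@fps_mul int/fps_one int]_(b <- B)
    \big[@fps_mul int/fps_one int]_(m <- iota 1 n |
      m \in multiples (omuln b (delta b))) fps_dilate m (fun=> 1%R)).
  rewrite -big_split big1 // => b _ /=.
  rewrite -big_split big_seq_cond big1 // => m /andP[].
  by rewrite mem_iota => /andP[m0 _] _; rewrite /= fps_mulC; exact: fps_geometric.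
have PFU : eq_upto n (fps_mul PF U) (fps_one int).
  have -> : fps_mul PF U = fps_mul (fps_mul (fps_mul PF U) W) W'.
    by rewrite -fps_mulA WW' [RHS]fps_mulC fps_mul1.
  by rewrite -WW'; exact: eq_upto_mul.
suff PQ : PF n = QF n.
  by apply/eqP; rewrite -(Num.Theory.eqr_nat int) mult_coef parts_coef PQ.
(* PF = PF (QF U) = (PF U) QF, which agrees with QF up to degree n. *)
rewrite -[PF]fps_mul1 -QFU fps_mulC [fps_mul QF U]fps_mulC fps_mulA.
by rewrite (eq_upto_mul _ _ _ QF QF PFU) // fps_mul1.
Qed.
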